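(* Let $r,n\ge1$ and let $\mathsf{O}$ be an $r$-symplectic oscillating tableau of weight zero and length $n$. Then $$\mathsf{G}_O(\mathsf{O})=\mathsf{M}_O(\mathsf{O}),$$ i.e. the filling of its growth diagram and the filling of its promotion matrix coincide.
   Context: Partitions with at most $r$ parts are identified with weakly decreasing $r$-tuples of nonnegative integers; $\emptyset=(0,\dots,0)$; $(\mu\cap\nu)_i=\min\{\mu_i,\nu_i\}$. For $x\in\mathbb{Z}^r$, $\mathrm{dom}(x)$ is obtained by sorting $|x_1|,\dots,|x_r|$ into weakly decreasing order. An $r$-symplectic oscillating tableau of length $n$ and weight zero is a sequence $\mathsf{O}=(\emptyset=\mu^0,\dots,\mu^n=\emptyset)$ of partitions with at most $r$ nonzero parts, consecutive ones differing by exactly one cell. Promotion. For $T=(\emptyset=\mu^0,\dots,\mu^n=\emptyset)$ let $\mathsf{pr}(T)=(\hat\mu^0,\dots,\hat\mu^n)$ with $\hat\mu^0=\emptyset$, $\hat\mu^j=\mathrm{dom}(\hat\mu^{j-1}+\mu^{j+1}-\mu^j)$ for $1\le j\le n-1$, $\hat\mu^n=\emptyset$. Matrix $\mathsf{M}_O(\mathsf{O})$. Let $T_i=\mathsf{pr}^i(\mathsf{O})=(T_i^0,\dots,T_i^n)$. $\mathsf{M}_O(\mathsf{O})=(m_{i,j})_{1\le i,j\le n}$ has $m_{i,i}=0$, and for $1\le i\le n$, $1\le d\le n-1$, $j\in\{1,\dots,n\}$, $j\equiv i+d\pmod n$: $m_{i,j}=1$ if $T_i^{d-1}+T_{i-1}^{d+1}-T_{i-1}^d$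 contains a negative entry and $m_{i,j}=0$ otherwise. Matrix $\mathsf{G}_O(\mathsf{O})$. Consider lattice points $(x,y)$ with $x,y\ge0$, $x+y\le n$, and unit cells with north-east corner $(x,y)$, $x,y\ge1$, $x+y\le n$. For such a cell let $\alpha,\beta,\gamma,\delta$ be the partitions labelling its corners $(x-1,y)$, $(x,y)$, $(x-1,y-1)$, $(x,y-1)$. Label $(x,n-x)$ by $\mu^x$ ($0\le x\le n$) and $(x,n-1-x)$ by $\mu^x\cap\mu^{x+1}$ ($0\le x\le n-1$). All other labels and the fillings are obtained by repeatedly applying the backward rules, computing $\gamma$ and the filling from $\alpha,\beta,\delta$ (the filling is $0$ unless stated otherwise): (B1) if $\beta=\delta=\alpha$, then $\gamma=\beta$; (B2) if $\beta=\delta\neq\alpha$, then $\gamma=\alpha$; (B3) if $\beta=\alpha\ne\delta$, then $\gamma=\delta$; (B4) if $\beta,\delta,\alpha$ are pairwise different, then $\gamma=\delta\cap\alpha$; (B5) if $\beta\ne\delta=\alpha$ and $\beta$ and $\delta=\alpha$ differ in row $k\ge2$, then $\gamma$ is obtained by deleting a square from row $k-1$ of $\delta=\alpha$; (B6) if $\beta\neq\delta=\alpha$ and they differ in the first row, then $\gamma=\delta=\alpha$ and the cell is filled with $1$. $\mathsf{G}_O(\mathsf{O})$ is the symmetric $n\times n$ matrix with zero diagonal whose $(i,j)$ entry, $1\le j<i\le n$, is the filling of the cell with north-east corner $(j,n+1-i)$. *)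

(* Defs.v *)
From mathcomp Require Import all_boot all_order all_algebra.

Set Implicit Arguments.
Unset Strict Implicit.
Unset Printing Implicit Defensive.

Import GRing.Theory.

(* Rows are numbered from 0, so the first row of a partition is row 0. *)

Section Partitions.

Variable r : nat.
Implicit Types (mu nu : r.-tuple nat).

Definition is_partition mu : bool := sorted geq mu.

Definition empty_part : r.-tuple nat := [tuple 0 | _ < r].

Definition cap_part mu nu : r.-tuple nat :=
  [tuple minn (tnth mu i) (tnth nu i) | i < r].

Definition add_one_cell mu nu : bool :=
  [exists k : 'I_r, [forall i : 'I_r, tnth nu i == tnth mu i + (i == k)]].

Definition differ_one_cell mu nu : bool :=
  add_one_cell mu nu || add_one_cell nu mu.

Definition dom (x : r.-tuple int) : r.-tuple nat :=
  [tuple of sort geq [tuple absz (tnth x i) | i < r]].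

Definition add_sub (a b c : r.-tuple nat) : r.-tuple int :=
  [tuple ((tnth a i)%:Z + (tnth b i)%:Z - (tnth c i)%:Z)%R | i < r].

Definition has_neg (x : r.-tuple int) : bool :=
  has (fun z : int => (z < 0)%R) x.

End Partitions.

Section Tableaux.

Variables r n : nat.
Implicit Types (T : n.+1.-tuple (r.-tuple nat)).

(* The j-th partition of T; the default value is returned only for j > n. *)
Definition step T (j : nat) : r.-tuple nat := nth (empty_part r) T j.

Definition oscillating_tableau T : Prop :=
  [/\ forall j, j <= n -> is_partition (step T j),
      step T 0 = empty_part r,
      step T n = empty_part r
    & forall j, j < n -> differ_one_cell (step T j) (step T j.+1)].

Fixpoint pr_step T (j : nat) : r.-tuple nat :=
  if j is j'.+1
  then dom (add_sub (pr_step T j') (step T j'.+2) (step T j'.+1))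
  else empty_part r.

Definition pr T : n.+1.-tuple (r.-tuple nat) :=
  [tuple if j == n :> nat then empty_part r else pr_step T j | j < n.+1].

(* The ordinals i, j : 'I_n stand for the indices i + 1, j + 1 of {1, ..., n};
   d is the element of {0, ..., n - 1} congruent to j - i modulo n, and d = 0
   exactly on the diagonal. *)
Definition promotion_matrix T : 'M[nat]_n :=
  \matrix_(i, j)
    let d := (j + n - i) %% n in
    if d == 0 then 0
    else nat_of_bool
      (has_neg (add_sub (step (iter i.+1 pr T) d.-1)
                        (step (iter i pr T) d.+1)
                        (step (iter i pr T) d))).

Definition delete_cell (mu : r.-tuple nat) (k : nat) : r.-tuple nat :=
  [tuple if i == k :> nat then (tnth mu i).-1 else tnth mu i | i < r].

(* The pair (gamma, filling) given by rules (B1) to (B6).  Partitions at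
   adjacent lattice points differ by at most one cell, so [pick] finds the
   only row in which beta and delta differ; the None branch is not reached. *)
Definition backward (alpha beta delta : r.-tuple nat) : r.-tuple nat * nat :=
  if beta == delta then
    if beta == alpha then (beta, 0) else (alpha, 0)
  else if beta == alpha then (delta, 0)
  else if delta != alpha then (cap_part delta alpha, 0)
  else if [pick k : 'I_r | tnth beta k != tnth delta k] is Some k then
    if k == 0 :> nat then (delta, 1) else (delete_cell delta k.-1, 0)
  else (delta, 0).

(* The label of the lattice point (x, n - k - x). *)
Fixpoint antidiag_label T (k x : nat) : r.-tuple nat :=
  if k is k1.+1 then
    if k1 is k0.+1 then
      (backward (antidiag_label T k1 x)
                (antidiag_label T k0 x.+1)
                (antidiag_label T k1 x.+1)).1
    else cap_part (step T x) (step T x.+1)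
  else step T x.

(* The label of the lattice point (x, y), for x + y <= n. *)
Definition growth_label T (x y : nat) : r.-tuple nat :=
  antidiag_label T (n - (x + y)) x.

(* The filling of the cell with north-east corner (x, y), for x, y >= 1 and
   x + y <= n. *)
Definition growth_filling T (x y : nat) : nat :=
  (backward (growth_label T x.-1 y)
            (growth_label T x y)
            (growth_label T x y.-1)).2.

(* With 1-based indices j < i the entry is the filling of the cell with
   north-east corner (j, n + 1 - i), that is, (j + 1, n - i) for the ordinals
   i, j : 'I_n. *)
Definition growth_matrix T : 'M[nat]_n :=
  \matrix_(i, j)
    if i == j then 0 else growth_filling T (minn i j).+1 (n - maxn i j).

End Tableaux.

(* Main.v *)
Require Import Defs.
From mathcomp Require Import all_boot all_order all_algebra.
From mathcomp Require Import perm.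
From mathcomp Require Import zify.

Set Implicit Arguments.
Unset Strict Implicit.
Unset Printing Implicit Defensive.

(** The growth diagram records a matching of {1, ..., n} and promotion rotates
this matching; the theorem follows by comparing the first rows of the two
matrices and rotating.

Write A(x, z) for the label of the lattice point (x, n - z), 0 <= x <= z <= n,
let A' be the same family for pr T, and put D(x, z) = A(x + 1, z + 1).  On the
diagonal z = x, the label A' starts one cell below D.  The promotion rule keeps
it one cell below D until the unique index p at which a negative entry appears;
there A' and D exchange their shapes, and from then on A' is one cell above D
[crossing_exists].  The comparison propagates away from the diagonal: A' is one
cell below D for z < p, equal to D for x < p <= z, and one cell above D for
p <= x [growth_edges].  Combinatorially, passing from T to pr T removes the arc
of the matching at 1 and inserts an arc ending at n; this changes the labels by
jeu de taquin in one direction [slide] and by column insertion in the other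
[column].  That both rules are compatible with the backward rules is a
statement about a cube of partitions [cube], with a degenerate form along the
lines z = p and x = p [transition].

Consequently the filling of pr T is that of T with its first row and column
removed and a new last row and column added, whose only nonzero entry is at p;
the only nonzero entry in the first row and column of the filling of T is at
p + 1 [growth_rotation].  So the first rows of the two matrices agree for every
tableau.  Row i + 1 of the promotion matrix of T is, up to a cyclic shift of
the columns, row i of that of pr T, and the rotation property gives the same
relation for the growth matrix [growth_entry_promotion].  The symmetry of the
growth matrix is what turns its first column into the missing entries of the
rotated row. *)

(** * Partitions and cells *)

Section Rows.

Variable r : nat.
Implicit Types (mu nu al be de ga la ka : r.-tuple nat).

(** Row lengths, extended by 0 beyond the last row. *)
Definition row mu i := nth 0 mu i.

(** The shape nu is mu with one cell added in row k (rows start at 0).  This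
forces k < r, since the rows from r on vanish. *)
Definition adds mu nu k := forall i, row nu i = row mu i + (i == k).

End Rows.

(** Row identities follow by linear arithmetic from the values at row i of
all the cell additions in the context. *)
Ltac rows_at i := repeat
  match goal with H : adds _ _ _ |- _ => move: (H i); clear H end.
Ltac rows := let i := fresh "i" in move=> i; rows_at i; lia.

Section Cells.

Variable r : nat.
Implicit Types (mu nu al be de ga la ka : r.-tuple nat).

Lemma row_inj mu nu : row mu =1 row nu -> mu = nu.
Proof.
move=> e; apply: eq_from_tnth => i.
by rewrite !(tnth_nth 0); exact: e.
Qed.

Lemma row_tuple (f : 'I_r -> nat) (g : nat -> nat) :
  (forall i, f i = g i) -> forall i,
  row [tuple f i | i < r] i = if i < r then g i else 0.
Proof.
move=> e i; case: ltnP => hi.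
  by rewrite -[i]/(nat_of_ord (Ordinal hi)) /row -tnth_nth tnth_mktuple e.
by rewrite /row nth_default // size_tuple.
Qed.

Lemma row_over mu i : r <= i -> row mu i = 0.
Proof. by move=> hi; rewrite /row nth_default // size_tuple. Qed.

Lemma row_empty i : row (empty_part r) i = 0.
Proof. by rewrite (row_tuple (g := fun=> 0)) //; case: ifP. Qed.

Lemma row_cap mu nu i : row (cap_part mu nu) i = minn (row mu i) (row nu i).
Proof.
rewrite (row_tuple (g := fun i => minn (row mu i) (row nu i))).
  by case: ltnP => // hi; rewrite !row_over.
by move=> j; rewrite !(tnth_nth 0).
Qed.

Lemma row_delete mu k i :
  row (delete_cell mu k) i = if i == k then (row mu i).-1 else row mu i.
Proof.
rewrite (row_tuple (g := fun i => if i == k then (row mu i).-1 else row mu i)).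
  by case: ltnP => // hi; rewrite !row_over // if_same.
by move=> j; rewrite !(tnth_nth 0).
Qed.

Lemma partitionP mu :
  reflect (forall i, row mu i.+1 <= row mu i) (is_partition mu).
Proof.
apply: (iffP (sortedP 0)) => h i.
  case: (ltnP i.+1 (size mu)) => hi; first exact: h.
  by rewrite row_over // -(size_tuple mu).
by move=> _; exact: h.
Qed.

Lemma partition_anti mu i j :
  is_partition mu -> i <= j -> row mu j <= row mu i.
Proof.
move/partitionP=> h; elim: j => [|j IH]; first by rewrite leqn0 => /eqP->.
by rewrite leq_eqVlt => /orP[/eqP->//|/IH]; exact: leq_trans.
Qed.

Lemma partition_empty : is_partition (empty_part r).
Proof. by apply/partitionP=> i; rewrite !row_empty. Qed.

Lemma adds_lt mu nu k : adds mu nu k -> k < r.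
Proof.
move=> h; rewrite ltnNge; apply/negP=> hk; move: (h k).
by rewrite !row_over // eqxx.
Qed.

Lemma adds_neq mu nu k : adds mu nu k -> mu <> nu.
Proof. by move=> h e; move: (h k); rewrite e eqxx; lia. Qed.

Lemma adds_exists mu k : k < r -> exists nu, adds mu nu k.
Proof.
move=> hk; exists [tuple row mu i + (i == k :> nat) | i < r] => i.
rewrite (row_tuple (g := fun i => row mu i + (i == k))) //.
by case: ltnP => // hi; rewrite row_over //; lia.
Qed.

Lemma adds_delete mu k : 0 < row mu k -> adds (delete_cell mu k) mu k.
Proof. by move=> h i; rewrite row_delete; case: eqP => [->|_]; lia. Qed.

Lemma add_one_cellP mu nu :
  reflect (exists k, adds mu nu k) (add_one_cell mu nu).
Proof.
apply: (iffP existsP) => [[k /forallP h]|[k h]].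
  exists (nat_of_ord k) => i; case: (ltnP i r) => hi.
    by have /eqP := h (Ordinal hi); rewrite !(tnth_nth 0).
  by rewrite !row_over //; have := ltn_ord k; lia.
exists (Ordinal (adds_lt h)); apply/forallP=> i.
by rewrite !(tnth_nth 0); apply/eqP; exact: h.
Qed.

Lemma cap_adds mu nu k : adds mu nu k -> cap_part mu nu = mu.
Proof. by move=> h; apply: row_inj => i; rewrite row_cap h; lia. Qed.

Lemma cap_partC mu nu : cap_part mu nu = cap_part nu mu.
Proof. by apply: row_inj => i; rewrite !row_cap minnC. Qed.

Lemma adds_uniq_l mu mu' nu k : adds mu nu k -> adds mu' nu k -> mu = mu'.
Proof. by move=> h h'; apply: row_inj => i; move: (h i) (h' i); lia. Qed.

Lemma adds_uniq_r mu nu nu' k : adds mu nu k -> adds mu nu' k -> nu = nu'.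
Proof. by move=> h h'; apply: row_inj => i; move: (h i) (h' i); lia. Qed.

Lemma adds_empty_row nu k : is_partition nu -> adds (empty_part r) nu k -> k = 0.
Proof.
move=> /partition_anti p h; move: (p 0 k) (h 0) (h k).
by rewrite !row_empty; lia.
Qed.

(** * The backward rules *)

(** The following lemmas restate (B1) to (B6) in terms of added cells; the first
two cover (B1) together with (B2) and (B3). *)

Lemma backward_right al be : backward al be be = (al, 0).
Proof. by rewrite /backward eqxx; case: eqP => [->|]. Qed.

Lemma backward_left be de : backward be be de = (de, 0).
Proof. by rewrite /backward eqxx; case: eqP => [->|]. Qed.

Lemma backwardC al be de : backward al be de = backward de be al.
Proof.
rewrite /backward; case: (be =P de) => bd; case: (be =P al) => ba //.
rewrite (eq_sym al de); case: eqP => /= [->//|_].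
by rewrite cap_partC.
Qed.

Lemma backward_meet al be de b c :
  adds al be b -> adds de be c -> b != c ->
  exists ga, [/\ backward al be de = (ga, 0), adds ga de b & adds ga al c].
Proof.
move=> hb hc bc; exists (cap_part de al); split.
- rewrite /backward; case: eqP => [e|_]; first by case: (adds_neq hc).
  case: eqP => [e|_]; first by case: (adds_neq hb).
  case: (de =P al) => //= e; move: (hb b) (hc b); rewrite e; lia.
- by move=> i; rewrite row_cap; move: (hb i) (hc i); lia.
- by move=> i; rewrite row_cap; move: (hb i) (hc i); lia.
Qed.

Lemma backward_same al be k : adds al be k ->
  backward al be al = if k == 0 then (al, 1) else (delete_cell al k.-1, 0).
Proof.
move=> h; rewrite /backward.
case: eqP => [e|_]; first by case: (adds_neq h).
rewrite eqxx /=; case: pickP => [j|/(_ (Ordinal (adds_lt h)))].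
  by rewrite !(tnth_nth 0) [nth _ be _]h; case: (j =P k :> nat) => [-> //|_];
    rewrite addn0 eqxx.
by rewrite !(tnth_nth 0) [nth _ be _]h /= eqxx -/(row al k); lia.
Qed.

Lemma backward_first al be : adds al be 0 -> backward al be al = (al, 1).
Proof. by move/backward_same. Qed.

Lemma backward_delete al be k : is_partition be -> adds al be k.+1 ->
  exists2 ga, backward al be al = (ga, 0) & adds ga al k.
Proof.
move=> /partitionP p h; exists (delete_cell al k);
  first by rewrite (backward_same h).
by apply: adds_delete; move: (p k) (h k) (h k.+1); lia.
Qed.

(** Containment with at most one additional cell: the relation between labels
of adjacent lattice points. *)
Definition sub1 mu nu := mu = nu \/ exists k, adds mu nu k.

Lemma backward_sub1 al be de :
  is_partition al -> is_partition be -> is_partition de ->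
  sub1 al be -> sub1 de be ->
  [/\ is_partition (backward al be de).1,
      sub1 (backward al be de).1 al & sub1 (backward al be de).1 de].
Proof.
move=> pa pb pd [->|[b hb]]; first by rewrite backward_left; split => //; left.
case=> [->|[c hc]].
  by rewrite backward_right; split => //; [left|right; exists b].
case: (b =P c) => [e|/eqP bc].
  have {hc e}-> : de = al by apply: adds_uniq_l hc _; rewrite -e.
  case: b hb => [|k] hb; first by rewrite (backward_first hb); split => //; left.
  have [ga -> h] := backward_delete pb hb; split; try by right; exists k.
  apply/partitionP=> i /=; have /partitionP/(_ i) := pa; have /partitionP/(_ i) := pb.
  by move: (hb i) (hb i.+1) (h i) (h i.+1); lia.
have [ga [-> h1 h2]] := backward_meet hb hc bc.
split; [|by right; exists c|by right; exists b].
apply/partitionP=> i /=; have /partitionP/(_ i) := pa; have /partitionP/(_ i) := pd.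
move: (hb i) (hb i.+1) (h1 i) (h1 i.+1) (h2 i) (h2 i.+1) (hc i) (hc i.+1).
by lia.
Qed.

(** * Jeu de taquin and column insertion squares *)

(** The jeu de taquin rule: al' is al plus a cell, be is al plus at most one
cell, and be' completes the square.  When be' has two more cells than al, the
intermediate shapes al' and be are distinct whenever the interval from al to
be' allows it.  It does not exactly when these two cells form a horizontal
domino (c = a) or a vertical one (c = a.+1). *)
Inductive slide al al' be be' : Prop :=
| Slide_stay a of al = be & al' = be' & adds al al' a
| Slide_comm a b of a != b & adds al al' a & adds al be b & adds be be' a
| Slide_bump a c of al' = be & adds al be a & adds be be' c &
    c = a \/ c = a.+1 /\ row al a = row al a.+1.

(** The column insertion rule: de' is de plus a cell and be is de plus at most
one cell.  If both additions use the same cell, in row a, then be' has its new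
cell in the column immediately to the right: in the row c <= a of be whose
length equals that of row a. *)
Inductive column de de' be be' : Prop :=
| Column_stay a of de = be & de' = be' & adds de de' a
| Column_comm a b of a != b & adds de de' a & adds de be b & adds be be' a
| Column_bump a c of de' = be & adds de be a & adds be be' c &
    c <= a /\ row be c = row be a.

Lemma slide_source al al' be be' : slide al al' be be' ->
  exists a, adds al al' a.
Proof. by case=> [a _ _ h|a b _ h _ _|a c -> h _ _]; exists a. Qed.

Lemma slide_target al al' be be' : slide al al' be be' ->
  exists a, adds be be' a.
Proof.
by case=> [a <- <- h|a b _ _ _ h|a c _ _ h _]; [exists a|exists a|exists c].
Qed.

Lemma column_source de de' be be' : column de de' be be' ->
  exists a, adds de de' a.
Proof. by case=> [a _ _ h|a b _ h _ _|a c -> h _ _]; exists a. Qed.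

Lemma column_target de de' be be' : column de de' be be' ->
  exists a, adds be be' a.
Proof.
by case=> [a <- <- h|a b _ _ _ h|a c _ _ h _]; [exists a|exists a|exists c].
Qed.

Lemma adds_square la ka mu nu a b :
  adds la ka a -> adds la mu b -> adds mu nu a -> adds ka nu b.
Proof. by move=> h1 h2 h3; rows. Qed.

(** Given the cells of two growth diagrams with corners al, be, de and al', be',
de', a slide along the edge al-be and a column square along de-be force equal
fillings, a slide along the opposite edge ga-de and a column square along
ga-al.  The proof runs through the rules for the two edges; outside the two
constant cases, h is the row of the cell of be' not in be. *)
Lemma cube al al' be be' de de' :
  is_partition al -> is_partition be -> is_partition be' -> is_partition de' ->
  slide al al' be be' -> column de de' be be' ->
  [/\ (backward al be de).2 = (backward al' be' de').2,
      slide (backward al be de).1 (backward al' be' de').1 de de'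
    & column (backward al be de).1 (backward al' be' de').1 al al'].
Proof.
move=> pa pb pb' pd' hJ hC.
case: (hC) => [a ea ea' hd | h c hch hd hc hbb | c h ed hc hbb [hle hrow]].
- subst be be'; rewrite !backward_right /=; split => //.
  by have [a' h] := slide_source hJ; exact: (Column_stay erefl erefl h).
- have hc' := adds_square hd hc hbb.
  case: (hJ) => [a ea ea' ha | h' b hb ha hab hbb' | b h' ea hab hbb' hJ'].
  + subst be be'; rewrite !backward_left /=; split => //.
    exact: (Slide_stay erefl erefl hd).
  + have e : h' = h by move: (hbb h') (hbb' h'); lia.
    rewrite {}e {h'} in hb ha hbb'.
    have hb' := adds_square ha hab hbb.
    case: (b =P c) => [e|/eqP bc].
      have {}ede : de = al by apply: (adds_uniq_l hc); rewrite -e.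
      have {}ede' : de' = al' by apply: (adds_uniq_l hc'); rewrite -e.
      subst c de de'.
      case: b => [|k] in hb hab hc hch hc' hb' * .
        rewrite (backward_first hab) (backward_first hb') /=; split => //.
          exact: (Slide_stay erefl erefl ha).
        exact: (Column_stay erefl erefl ha).
      have [ga -> hg] := backward_delete pb hab.
      have [ga' -> hg'] := backward_delete pb' hb'.
      have hgg : adds ga ga' h by rows.
      split=> //=.
        case: (h =P k) => [e|/eqP hk]; last exact: (Slide_comm hk hgg hg ha).
        subst h.
        have e := adds_uniq_r hgg hg.
        by apply: (Slide_bump (a := k) (c := k)) => //; left.
      case: (h =P k) => [e|/eqP hk]; last exact: (Column_comm hk hgg hg ha).
      subst h.
      have e := adds_uniq_r hgg hg.
      by apply: (Column_bump (a := k) (c := k)) => //; left.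
    have [ga [-> hg1 hg2]] := backward_meet hab hc bc.
    have [ga' [-> hg1' hg2']] := backward_meet hb' hc' bc.
    have hgg : adds ga ga' h by rows.
    split=> //=; first exact: (Slide_comm hb hgg hg1 hd).
    exact: (Column_comm hch hgg hg2 ha).
  + have e : h' = h by move: (hbb h') (hbb' h'); lia.
    rewrite {}e {h'} in hbb' hJ'; subst al'.
    case: (b =P c) => [e|/eqP bc].
      have {}ede : de = al by apply: (adds_uniq_l hc); rewrite -e.
      (* The shape de' would not be a partition. *)
      subst c de; exfalso.
      case: hJ' => [e|[e hrow]]; first by rewrite e eqxx in hch.
      subst h; move/partitionP/(_ b): pd'.
      by move: (hd b) (hd b.+1); lia.
    have [ga [-> hg1 hg2]] := backward_meet hab hc bc.
    have [ga' [-> hg1' hg2']] := backward_meet hbb hc' hch.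
    have e := adds_uniq_l hg1' hd; subst ga'.
    split=> //=; last exact: (Column_comm bc hg1 hg2 hab).
    apply: (Slide_bump (a := b) (c := h)) => //.
    case: hJ' => [->|[e' hrow]]; [by left|right; split=> //].
    by subst h; move: (hg2 b) (hg2 b.+1); lia.
- subst de'.
  case: (hJ) => [a ea ea' ha | h' b hb ha hab hbb' | b h' ea hab hbb' hJ'].
  + subst be be'; rewrite !backward_left /=; split => //.
    exact: (Slide_stay erefl erefl hc).
  + have e : h' = h by move: (hbb h') (hbb' h'); lia.
    rewrite {}e {h'} in hb ha hbb'.
    have hb' := adds_square ha hab hbb.
    have nbh : b != h by rewrite eq_sym.
    have [ga' [-> hg1' hg2']] := backward_meet hb' hbb nbh.
    have e := adds_uniq_l hg2' ha; subst ga'.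
    case: (b =P c) => [e|/eqP bc].
      have {}ede : de = al by apply: (adds_uniq_l hc); rewrite -e.
      subst c de.
      case: b => [|k] in hb hab hb' hc hle hrow hg1' nbh *; first by move: hb; lia.
      have [ga -> hg] := backward_delete pb hab.
      have hhk : h <= k by lia.
      have hbk : row be k = row be k.+1.
        have := partition_anti pb hhk; have /partitionP/(_ k) := pb; lia.
      split=> //=.
        apply: (Slide_bump (a := k) (c := k.+1)) => //; right; split=> //.
        by move: (hg k) (hg k.+1) (hab k) (hab k.+1); lia.
      apply: (Column_bump (a := k) (c := h)) => //; split=> //.
      by move: (hab h) (hab k); lia.
    have ncb : c != b by rewrite eq_sym.
    have [ga [-> hg1 hg2]] := backward_meet hab hc bc.
    split=> //=; first exact: (Slide_comm ncb hg2 hg1 hc).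
    apply: (Column_bump (a := c) (c := h)) => //; split=> //.
    by move: (hab h) (hab c); lia.
  + have e : h' = h by move: (hbb h') (hbb' h'); lia.
    rewrite {}e {h'} in hbb' hJ'; subst al'.
    case: (b =P c) => [e|/eqP bc].
      have {}ede : de = al by apply: (adds_uniq_l hc); rewrite -e.
      subst c de.
      have e : h = b by case: hJ' => [//|[e _]]; lia.
      subst h.
      case: b => [|k] in hab hbb hc hbb' hle hrow hJ' *.
        rewrite (backward_first hab) (backward_first hbb) /=; split => //.
          exact: (Slide_stay erefl erefl hab).
        exact: (Column_stay erefl erefl hab).
      have [ga -> hg] := backward_delete pb hab.
      have [ga' -> hg'] := backward_delete pb' hbb.
      have hgg : adds ga ga' k.+1 by rows.
      have nk : k.+1 != k by lia.
      split=> //=; first exact: (Slide_comm nk hgg hg hab).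
      exact: (Column_comm nk hgg hg hab).
    have ncb : c != b by rewrite eq_sym.
    have [ga [-> hg1 hg2]] := backward_meet hab hc bc.
    case: hJ' => [e|[e hrow']].
      (* The shape al would not be a partition. *)
      exfalso; subst h.
      have hbc : b.+1 <= c by lia.
      have := partition_anti pb hbc; move/partitionP/(_ b): pa.
      by move: (hab b) (hab b.+1); lia.
    subst h.
    have [ga' -> hg'] := backward_delete pb' hbb.
    have e := adds_uniq_l hg' hab; subst ga'.
    split=> //=; first exact: (Slide_comm ncb hg2 hg1 hc).
    apply: (Column_bump (a := c) (c := b)) => //; split; first by lia.
    by move: (hab b) (hab b.+1) (hab c) (hg2 b) (hg2 c); lia.
Qed.

(** The case in which, in the second diagram, de is the shape be of the first
and be' exceeds it by a cell in the first column.  In the first diagram the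
edge be-de is constant, so (B2) gives ga = al there; the second gives the same
shape. *)
Lemma transition al al' be be' h :
  is_partition be' -> slide al al' be be' -> adds be be' h -> row be h = 0 ->
  [/\ (backward al' be' be).2 = 0, (backward al' be' be).1 = al
    & exists2 k, adds al al' k & row al k = 0].
Proof.
move=> pb' hJ hbb hrow.
case: hJ => [a ea ea' ha | h' b hb ha hab hbb' | b h' ea hab hbb' hJ'].
- by subst be be'; rewrite backward_left; split=> //; exists h.
- have e : h' = h by move: (hbb h') (hbb' h'); lia.
  rewrite {}e {h'} in hb ha hbb'.
  have hb' := adds_square ha hab hbb.
  have nbh : b != h by rewrite eq_sym.
  have [ga' [-> hg1' hg2']] := backward_meet hb' hbb nbh.
  have e := adds_uniq_l hg2' ha; subst ga'; split=> //.
  by exists h => //; move: (hab h); lia.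
- have e : h' = h by move: (hbb h') (hbb' h'); lia.
  rewrite {}e {h'} in hbb' hJ'; subst al'.
  case: hJ' => [e|[e hrow']]; first by subst h; move: (hab b); lia.
  subst h.
  have [ga' -> hg'] := backward_delete pb' hbb.
  have e := adds_uniq_l hg' hab; subst ga'; split=> //.
  by exists b => //; move: (hab b) (hab b.+1); lia.
Qed.

End Cells.

(** The decrease from row i to row i + 1 of all the partitions in the
context. *)
Ltac parts i := repeat
  match goal with H : is_true (is_partition _) |- _ =>
    move: (elimT (partitionP _) H i); clear H end.

(** * The promotion rule on one cell *)

Section DomRule.

Variable r : nat.
Implicit Types (mu nu la ka : r.-tuple nat).

Lemma has_neg_add_subP (a b c : r.-tuple nat) :
  reflect (exists i, row a i + row b i < row c i) (has_neg (add_sub a b c)).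
Proof.
apply: (iffP has_tnthP) => [[i]|[i hi]].
  by rewrite tnth_mktuple !(tnth_nth 0) => h; exists (nat_of_ord i);
    rewrite /row; lia.
have ir : i < r by rewrite ltnNge; apply/negP=> ri; move: hi; rewrite !row_over.
exists (Ordinal ir); rewrite tnth_mktuple !(tnth_nth 0) /=.
by rewrite /row in hi; lia.
Qed.

Lemma dom_partition (x : r.-tuple int) : is_partition (dom x).
Proof. by apply: sort_sorted => m n; exact: leq_total. Qed.

(** The two truncated differences add up to the absolute value of an entry.
Sorting these absolute values amounts, in all the cases needed, to exchanging
two rows. *)
Lemma dom_add_sub_swap u v (a b c nu : r.-tuple nat) :
  u < r -> v < r -> is_partition nu ->
  (forall i, row a i + row b i - row c i + (row c i - (row a i + row b i)) =
     row nu (if i == u then v else if i == v then u else i)) ->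
  dom (add_sub a b c) = nu.
Proof.
move=> ur vr pn e; set s := tperm (Ordinal ur) (Ordinal vr).
have abs_perm : [tuple absz (tnth (add_sub a b c) i) | i < r] =
                [tuple tnth nu (s i) | i < r].
  apply: eq_from_tnth => i; rewrite !tnth_mktuple !(tnth_nth 0).
  have {e} := e i; rewrite /row /s.
  case: tpermP => [->|->|] /=; rewrite ?eqxx; try lia.
    by case: eqP => [->|]; lia.
  by move=> /eqP; rewrite -val_eqE => /negbTE /= -> /eqP;
    rewrite -val_eqE => /negbTE /= ->; lia.
apply: val_inj; apply: (@sorted_eq _ geq).
- by move=> y x z /= h1 h2; exact: leq_trans h2 h1.
- by move=> x y; rewrite /= andbC; exact: anti_leq.
- exact: dom_partition.
- exact: pn.
by rewrite /dom abs_perm perm_sort; apply/tuple_permP; exists s.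
Qed.

Lemma dom_add_sub (a b c nu : r.-tuple nat) : 0 < r -> is_partition nu ->
  (forall i, row a i + row b i - row c i + (row c i - (row a i + row b i)) =
     row nu i) ->
  dom (add_sub a b c) = nu.
Proof.
move=> r0 pn e; apply: (@dom_add_sub_swap 0 0) => // i.
by rewrite e; case: eqP => [->|].
Qed.

Lemma adds_partition_or mu nu k : is_partition mu -> adds mu nu k ->
  is_partition nu \/ exists2 j, k = j.+1 & row mu j = row mu j.+1.
Proof.
move=> pm h; case: k h => [|j] h.
  by left; apply/partitionP=> i; move: (h i) (h i.+1); parts i; lia.
case: (row mu j =P row mu j.+1) => [e|ne]; first by right; exists j.
left; apply/partitionP=> i; move: (h i) (h i.+1); parts i.
by case: (i =P j) => [->|]; lia.
Qed.

(** In the lemmas dom_before_up, dom_before_down, dom_crossing, dom_after_up and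
dom_after_down, the shapes la, ka, nu are consecutive values of pr T, T and T:
la at x, ka at x + 1 and nu at x + 2.  Before the crossing ka has one cell more
than la, after it one cell less. *)

Lemma dom_before_up la ka nu a b :
  is_partition la -> is_partition ka -> is_partition nu ->
  adds la ka a -> adds ka nu b ->
  [/\ has_neg (add_sub la nu ka) = false,
      exists k, adds la (dom (add_sub la nu ka)) k
    & slide la ka (dom (add_sub la nu ka)) nu].
Proof.
move=> pl pk pn ha hb.
have ra := adds_lt ha; have rb := adds_lt hb; have r0 : 0 < r by lia.
have -> : has_neg (add_sub la nu ka) = false.
  by apply/has_neg_add_subP=> -[i]; rows_at i; lia.
case: (a =P b) => [e|/eqP nab].
  subst b; have -> : dom (add_sub la nu ka) = ka.
    by apply: dom_add_sub => // i; rows_at i; lia.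
  split=> //; first by exists a.
  by apply: (Slide_bump (a := a) (c := a)) => //; left.
have [mu hm] := adds_exists la rb.
have [pm|[j e hj]] := adds_partition_or pl hm.
  have -> : dom (add_sub la nu ka) = mu.
    by apply: dom_add_sub => // i; rows_at i; lia.
  split=> //; first by exists b.
  by apply: (Slide_comm nab ha hm); rows.
subst b; have e : a = j by move: (ha j) (ha j.+1) (hb j) (hb j.+1); parts j; lia.
subst j; have -> : dom (add_sub la nu ka) = ka.
  apply: (@dom_add_sub_swap a a.+1) => // i;
    case: eqP => [->|ni]; last case: eqP => [->|ni'].
  - by move: (ha a) (ha a.+1) (hb a); lia.
  - by move: (ha a) (ha a.+1) (hb a.+1); lia.
  - by move: (ha i) (hb i); lia.
split=> //; first by exists a.
by apply: (Slide_bump (a := a) (c := a.+1)) => //; right.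
Qed.

Lemma last_equal_row la a : 0 < row la a -> is_partition la ->
  exists c, [/\ a <= c, row la c = row la a & row la c.+1 < row la c].
Proof.
move=> h pl.
have ex : exists c, row la c == row la a by exists a.
have bd c : row la c == row la a -> c <= r.
  by move=> e; rewrite leqNgt; apply/negP=> rc; move: h;
    rewrite -(eqP e) row_over // ltnW.
case: (ex_maxnP ex bd) => c /eqP e hc; exists c; split=> //; first exact: hc.
have := partition_anti pl (leqnSn c); rewrite leq_eqVlt => /orP[/eqP ee|//].
by have := hc c.+1; rewrite ee e eqxx ltnn => /(_ isT).
Qed.

Lemma first_equal_row la a : is_partition la ->
  exists c, [/\ c <= a, row la c = row la a &
    forall i, i.+1 = c -> row la c < row la i].
Proof.
move=> pl; have ex : exists c, row la c == row la a by exists a.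
case: (ex_minnP ex) => c /eqP e hc; exists c; split=> //; first exact: hc.
move=> i ei; rewrite ltnNge; apply/negP=> h; have := hc i.
by have := partition_anti pl (leqnSn i); rewrite ei => h';
  rewrite -e eqn_leq h h' => /(_ isT); lia.
Qed.

Lemma dom_before_down la ka nu a b :
  is_partition la -> is_partition ka -> is_partition nu ->
  adds la ka a -> adds nu ka b ->
  ~~ has_neg (add_sub la nu ka) ->
  (exists k, adds (dom (add_sub la nu ka)) la k)
  /\ column (dom (add_sub la nu ka)) nu la ka.
Proof.
move=> pl pk pn ha hb nneg.
have ra := adds_lt ha; have rb := adds_lt hb; have r0 : 0 < r by lia.
case: (a =P b) => [e|/eqP nab].
  subst b; have e := adds_uniq_l hb ha; subst nu.
  have la0 : 0 < row la a.
    rewrite lt0n; apply/eqP => l0; move/has_neg_add_subP: nneg; apply.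
    by exists a; move: (ha a); lia.
  (* Sorting moves the removed cell down to the last row of the same length. *)
  have [c [ac ec lc]] := last_equal_row la0 pl.
  have hm : adds (delete_cell la c) la c by apply: adds_delete; lia.
  have pm : is_partition (delete_cell la c).
    apply/partitionP=> i; move: (hm i) (hm i.+1); parts i.
    by case: (i =P c) => [->|]; lia.
  have rc := adds_lt hm.
  have -> : dom (add_sub la la ka) = delete_cell la c.
    apply: (@dom_add_sub_swap a c) => // i;
    case: eqP => [->|ni]; last case: eqP => [->|ni'].
    - by move: (ha a) (hm c) (hm a); lia.
    - by move: (ha c) (hm a) (hm c); lia.
    - by move: (ha i) (hm i); lia.
  split; first by exists c.
  by apply: (Column_bump (a := c) (c := a)).
have hm : adds (delete_cell la b) la b.
  by apply: adds_delete; move: (ha b) (hb b); lia.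
have pm : is_partition (delete_cell la b).
  apply/partitionP=> i; move: (ha i) (hb i) (hb i.+1) (ha i.+1) (hm i) (hm i.+1).
  by parts i; lia.
have -> : dom (add_sub la nu ka) = delete_cell la b.
  by apply: dom_add_sub => // i; rows_at i; lia.
split; first by exists b.
by apply: (Column_comm nab _ hm ha); rows.
Qed.

(** A negative entry can appear only if the step of T removes the cell by which
ka exceeds la and this cell is the only one in its row; the rule then puts the
cell back. *)
Lemma dom_crossing la ka nu a :
  is_partition la -> is_partition ka -> is_partition nu ->
  adds la ka a -> sub1 nu ka \/ sub1 ka nu -> has_neg (add_sub la nu ka) ->
  [/\ nu = la, dom (add_sub la nu ka) = ka & row la a = 0].
Proof.
move=> pl pk pn ha hs /has_neg_add_subP[i hi].
have ra := adds_lt ha; have r0 : 0 < r by lia.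
have [b hb] : exists b, adds nu ka b.
  case: hs => [] [e|[b hb]].
  - by subst nu; move: hi; lia.
  - by exists b.
  - by subst nu; move: hi; lia.
  - by move: hi (hb i); lia.
have e : a = b by move: hi (hb i) (ha i); lia.
subst b; have e := adds_uniq_l hb ha; subst nu.
have la0 : row la a = 0 by move: hi (ha i) ; case: (i =P a) => [->|]; lia.
split=> //; apply: dom_add_sub => // j; move: (ha j).
by case: (j =P a) => [->|]; lia.
Qed.

Lemma dom_after_up la ka nu a b :
  is_partition la -> is_partition ka -> is_partition nu ->
  adds ka la a -> adds ka nu b ->
  [/\ has_neg (add_sub la nu ka) = false,
      exists k, adds la (dom (add_sub la nu ka)) k
    & column ka la nu (dom (add_sub la nu ka))].
Proof.
move=> pl pk pn ha hb.
have ra := adds_lt ha; have rb := adds_lt hb; have r0 : 0 < r by lia.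
have -> : has_neg (add_sub la nu ka) = false.
  by apply/has_neg_add_subP=> -[i]; rows_at i; lia.
case: (a =P b) => [e|/eqP nab].
  subst b; have e := adds_uniq_r hb ha; subst nu.
  (* Sorting moves the added cell up to the first row of the same length. *)
  have [c [ca ec lc]] := first_equal_row a pl.
  have rc : c < r by lia.
  have [mu hm] := adds_exists la rc.
  have pm : is_partition mu.
    apply/partitionP=> i; move: (hm i) (hm i.+1) (lc i); parts i.
    by case: (i.+1 =P c) => [<-|]; lia.
  have -> : dom (add_sub la la ka) = mu.
    apply: (@dom_add_sub_swap a c) => // i;
    case: eqP => [->|ni]; last case: eqP => [->|ni'].
    - by move: (ha a) (hm c) (hm a); lia.
    - by move: (ha c) (hm a) (hm c); lia.
    - by move: (ha i) (hm i); lia.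
  split=> //; first by exists c.
  by apply: (Column_bump (a := a) (c := c)).
have [mu hm] := adds_exists la rb.
have pm : is_partition mu.
  apply/partitionP=> i; move: (ha i) (hb i) (hb i.+1) (ha i.+1) (hm i) (hm i.+1).
  by parts i; lia.
have -> : dom (add_sub la nu ka) = mu.
  by apply: dom_add_sub => // i; rows_at i; lia.
split=> //; first by exists b.
by apply: (Column_comm nab ha hb); rows.
Qed.

Lemma dom_after_down la ka nu a b :
  is_partition la -> is_partition ka -> is_partition nu ->
  adds ka la a -> adds nu ka b ->
  [/\ has_neg (add_sub la nu ka) = false,
      exists k, adds (dom (add_sub la nu ka)) la k
    & slide nu (dom (add_sub la nu ka)) ka la].
Proof.
move=> pl pk pn ha hb.
have ra := adds_lt ha; have rb := adds_lt hb; have r0 : 0 < r by lia.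
have -> : has_neg (add_sub la nu ka) = false.
  by apply/has_neg_add_subP=> -[i]; rows_at i; lia.
case: (a =P b) => [e|/eqP nab].
  subst b; have -> : dom (add_sub la nu ka) = ka.
    by apply: dom_add_sub => // i; rows_at i; lia.
  split=> //; first by exists a.
  by apply: (Slide_bump (a := a) (c := a)) => //; left.
have [mu hm] := adds_exists nu ra.
have hml : adds mu la b by rows.
have [pm|[j e hj]] := adds_partition_or pn hm.
  have -> : dom (add_sub la nu ka) = mu.
    by apply: dom_add_sub => // i; rows_at i; lia.
  split=> //; first by exists b.
  exact: (Slide_comm nab hm hb ha).
subst a; have e : b = j by move: (ha j) (ha j.+1) (hb j) (hb j.+1); parts j; lia.
subst j; have -> : dom (add_sub la nu ka) = ka.
  apply: (@dom_add_sub_swap b b.+1) => // i;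
    case: eqP => [->|ni]; last case: eqP => [->|ni'].
  - by move: (ha b) (hb b) (hb b.+1); lia.
  - by move: (ha b.+1) (hb b) (hb b.+1); lia.
  - by move: (ha i) (hb i); lia.
split=> //; first by exists b.+1.
by apply: (Slide_bump (a := b) (c := b.+1)) => //; right.
Qed.

End DomRule.

(** * Labels along antidiagonals *)

Section Labels.

Variables r n : nat.
Implicit Types (T : n.+1.-tuple (r.-tuple nat)) (mu nu : r.-tuple nat).

Lemma differ_one_cellP mu nu :
  differ_one_cell mu nu -> (exists k, adds mu nu k) \/ (exists k, adds nu mu k).
Proof. by case/orP=> /add_one_cellP; [left|right]. Qed.

Lemma differ_cap_sub1 mu nu : differ_one_cell mu nu ->
  sub1 (cap_part mu nu) mu /\ sub1 (cap_part mu nu) nu.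
Proof.
case/differ_one_cellP=> [] [k h].
  by rewrite (cap_adds h); split; [left|right; exists k].
by rewrite cap_partC (cap_adds h); split; [right; exists k|left].
Qed.

Lemma sub1_empty mu : sub1 mu (empty_part r) -> mu = empty_part r.
Proof. by case=> [//|[k /(_ k)]]; rewrite row_empty eqxx; lia. Qed.

Lemma antidiag_label_sub1 T k : oscillating_tableau T ->
  (forall x, x + k <= n -> is_partition (antidiag_label T k x)) /\
  (forall x, x + k < n ->
     [/\ is_partition (antidiag_label T k.+1 x),
         sub1 (antidiag_label T k.+1 x) (antidiag_label T k x)
       & sub1 (antidiag_label T k.+1 x) (antidiag_label T k x.+1)]).
Proof.
case=> pT _ _ dT; elim: k => [|k [IH1 IH2]].
  split=> x hx; rewrite addn0 in hx; first exact: pT.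
  have [h1 h2] := differ_cap_sub1 (dT _ hx); split=> //=.
  apply/partitionP=> i; rewrite !row_cap.
  have /partitionP/(_ i) := pT _ (ltnW hx); have /partitionP/(_ i) := pT _ hx.
  by lia.
split=> x hx; rewrite addnS in hx; first by case: (IH2 x hx).
have [pa _ sa] := IH2 x (ltnW hx); have [pd sd _] := IH2 x.+1 hx.
by case: (backward_sub1 pa (IH1 x.+1 (ltnW hx)) pd sa sd).
Qed.

Lemma antidiag_label_partition T k x : oscillating_tableau T -> x + k <= n ->
  is_partition (antidiag_label T k x).
Proof. by move=> oT; apply: (antidiag_label_sub1 k oT).1. Qed.

Lemma antidiag_label_left T k : oscillating_tableau T -> k <= n ->
  antidiag_label T k 0 = empty_part r.
Proof.
move=> oT; elim: k => [|k IH] hk; first by case: oT.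
have [_ h _] := (antidiag_label_sub1 k oT).2 0 hk.
by apply: sub1_empty; rewrite -(IH (ltnW hk)).
Qed.

Lemma antidiag_label_bottom T k x : oscillating_tableau T -> x + k = n ->
  antidiag_label T k x = empty_part r.
Proof.
move=> oT; elim: k x => [|k IH] x hx.
  by rewrite addn0 in hx; rewrite hx /=; case: oT.
have hx' : x + k < n by lia.
have [_ _ h] := (antidiag_label_sub1 k oT).2 x hx'.
by apply: sub1_empty; rewrite -(IH x.+1) //; lia.
Qed.

(** Relation between two diagrams along the horizontal edge from (x, z) to
(x + 1, z): a, a' are the labels of A' at its ends and d, d' those of D.  The
four cases are z < p, then x + 1 < p <= z, x + 1 = p <= z and p <= x.  In the
third case d' and a' differ by a cell in the first column. *)
Definition hedge p x z (a d a' d' : r.-tuple nat) : Prop :=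
  if z < p then slide a d a' d'
  else if x.+1 < p then a = d /\ a' = d'
  else if x.+1 == p then
    [/\ a = d, d' = d & exists2 h, adds d' a' h & row d' h = 0]
  else column d a d' a'.

(** The same along the vertical edge between (x, z + 1), with labels a and d, and
(x, z), with labels a' and d'. *)
Definition vedge p x z (a d a' d' : r.-tuple nat) : Prop :=
  if z.+1 < p then column a d a' d'
  else if z.+1 == p then
    [/\ a = d, a' = d & exists2 h, adds a' d' h & row a' h = 0]
  else if x < p then a = d /\ a' = d'
  else slide d a d' a'.

(** One cell of both diagrams, with corners (x, z), (x + 1, z), (x + 1, z + 1)
for al, be, de: the relations on two edges imply those on the other two, and
the fillings agree.  After the crossing A' and D exchange roles, and so do the
two directions, which the symmetry of the backward rules in al and de allows. *)
Lemma cell p x z (aA aD bA bD dA dD : r.-tuple nat) :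
  x < z ->
  is_partition aA -> is_partition aD -> is_partition bA -> is_partition bD ->
  is_partition dA -> is_partition dD ->
  hedge p x z aA aD bA bD -> vedge p x.+1 z dA dD bA bD ->
  let A := backward aA bA dA in let D := backward aD bD dD in
  [/\ A.2 = D.2, hedge p x z.+1 A.1 D.1 dA dD & vedge p x z A.1 D.1 aA aD].
Proof.
move=> xz paA paD pbA pbD pdA pdD; rewrite /hedge /vedge /=.
case: (ltngtP z.+1 p) => hz.
- by move=> hJ hC; exact: (cube paA pbA pbD pdD hJ hC).
- case: (ltngtP x.+1 p) => hx.
  + by move=> [-> ->] [-> _].
  + move=> hC hJ; rewrite (backwardC aA) (backwardC aD).
    by have [-> h1 h2] := cube pdD pbD pbA paA hJ hC.
  + move=> [-> -> [h hb hr]] hJ; rewrite (backwardC _ bA).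
    have [-> -> hk] := transition pbA hJ hb hr.
    by rewrite backward_left.
- subst p => hJ [-> <- [h hb hr]].
  have [-> -> hk] := transition pbD hJ hb hr.
  by rewrite backward_right ltnS xz.
Qed.

End Labels.

(** * Promotion of an oscillating tableau *)

Section Promotion.

Variables r n : nat.
Implicit Types (T : n.+1.-tuple (r.-tuple nat)) (mu nu : r.-tuple nat).

(** The entry of the first row of the promotion matrix at distance d from the
diagonal. *)
Definition neg_step T d :=
  has_neg (add_sub (step (pr T) d.-1) (step T d.+1) (step T d)).

Lemma step_pr T j : j < n -> step (pr T) j = pr_step T j.
Proof.
move=> jn; have jn1 : j < n.+1 by exact: ltnW.
rewrite /step -[j]/(nat_of_ord (Ordinal jn1)) -tnth_nth tnth_mktuple /=.
by rewrite ltn_eqF.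
Qed.

Lemma step_pr0 T : 0 < n -> step (pr T) 0 = empty_part r.
Proof. by move=> n0; rewrite step_pr. Qed.

Lemma step_prn T : step (pr T) n = empty_part r.
Proof.
rewrite /step -[X in nth _ _ X]/(nat_of_ord (@ord_max n)) -tnth_nth.
by rewrite tnth_mktuple /= eqxx.
Qed.

Lemma step_prS T j : j.+1 < n ->
  step (pr T) j.+1 = dom (add_sub (step (pr T) j) (step T j.+2) (step T j.+1)).
Proof. by move=> jn; rewrite !step_pr // ltnW. Qed.

Lemma step_pr_partition T j : is_partition (step (pr T) j).
Proof.
case: (ltnP j n) => jn; last first.
  move: jn; rewrite leq_eqVlt => /orP[/eqP<-|jn].
    by rewrite step_prn; exact: partition_empty.
  by rewrite /step nth_default ?size_tuple //; exact: partition_empty.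
case: j jn => [|j] jn; first by rewrite step_pr0 //; exact: partition_empty.
by rewrite step_prS //; exact: dom_partition.
Qed.

(** Position of pr T relative to the shifted tableau: one cell below it, or one
cell above. *)
Definition before T x := exists a, adds (step (pr T) x) (step T x.+1) a.
Definition after T x := exists a, adds (step T x.+1) (step (pr T) x) a.

Lemma differ_adds mu nu k : adds mu nu k -> differ_one_cell mu nu.
Proof. by move=> h; apply/orP; left; apply/add_one_cellP; exists k. Qed.

Lemma differ_adds_rev mu nu k : adds nu mu k -> differ_one_cell mu nu.
Proof. by move=> h; apply/orP; right; apply/add_one_cellP; exists k. Qed.

Lemma before_step T x : oscillating_tableau T -> x.+1 < n -> before T x ->
  ~~ neg_step T x.+1 ->
  [/\ before T x.+1, differ_one_cell (step (pr T) x) (step (pr T) x.+1),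
      slide (antidiag_label (pr T) 1 x) (antidiag_label T 1 x.+1)
            (step (pr T) x.+1) (step T x.+2)
    & column (antidiag_label (pr T) 1 x) (antidiag_label T 1 x.+1)
             (step (pr T) x) (step T x.+1)].
Proof.
move=> [pT _ _ dT] xn [a ha]; rewrite /neg_step /=.
have pl := step_pr_partition T x.
have pk := pT _ (ltnW xn); have pn := pT _ xn.
case: (differ_one_cellP (dT _ xn)) => [] [b hb].
  have [_ [k hk] hJ] := dom_before_up pl pk pn ha hb.
  rewrite -(step_prS _ xn) in hk hJ => _.
  rewrite (cap_adds hk) (cap_adds hb); split=> //.
  - exact: slide_target hJ.
  - exact: differ_adds hk.
  - exact: (Column_stay erefl erefl ha).
move=> nneg; have [[k hk] hC] := dom_before_down pl pk pn ha hb nneg.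
rewrite -(step_prS _ xn) in hk hC.
have hs := column_source hC.
rewrite cap_partC (cap_adds hk) cap_partC (cap_adds hb); split=> //.
- exact: differ_adds_rev hk.
- by case: hs => c hc; exact: (Slide_stay erefl erefl hc).
Qed.

Lemma cross_step T x : oscillating_tableau T -> x.+1 < n -> before T x ->
  neg_step T x.+1 ->
  [/\ after T x.+1, differ_one_cell (step (pr T) x) (step (pr T) x.+1),
      [/\ antidiag_label (pr T) 1 x = antidiag_label T 1 x.+1,
          step T x.+2 = antidiag_label T 1 x.+1
        & exists2 h, adds (step T x.+2) (step (pr T) x.+1) h
            & row (step T x.+2) h = 0]
    & [/\ antidiag_label (pr T) 1 x = antidiag_label T 1 x.+1,
          step (pr T) x = antidiag_label T 1 x.+1
        & exists2 h, adds (step (pr T) x) (step T x.+1) h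
            & row (step (pr T) x) h = 0]].
Proof.
move=> [pT _ _ dT] xn [a ha]; rewrite /neg_step /= /after.
have pl := step_pr_partition T x.
have pk := pT _ (ltnW xn); have pn := pT _ xn.
have hs : sub1 (step T x.+2) (step T x.+1) \/ sub1 (step T x.+1) (step T x.+2).
  by case: (differ_one_cellP (dT _ xn)) => h; [right|left]; right.
move=> hneg; have [e1 e2 e3] := dom_crossing pl pk pn ha hs hneg.
rewrite -(step_prS _ xn) in e2.
rewrite e1 e2 (cap_adds ha) cap_partC (cap_adds ha).
by split=> //; [exists a | exact: differ_adds ha | split=> //; exists a..].
Qed.

Lemma after_step T x : oscillating_tableau T -> x.+1 < n -> after T x ->
  [/\ neg_step T x.+1 = false, after T x.+1,
      differ_one_cell (step (pr T) x) (step (pr T) x.+1),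
      column (antidiag_label T 1 x.+1) (antidiag_label (pr T) 1 x)
             (step T x.+2) (step (pr T) x.+1)
    & slide (antidiag_label T 1 x.+1) (antidiag_label (pr T) 1 x)
            (step T x.+1) (step (pr T) x)].
Proof.
move=> [pT _ _ dT] xn [a ha]; rewrite /neg_step /=.
have pl := step_pr_partition T x.
have pk := pT _ (ltnW xn); have pn := pT _ xn.
case: (differ_one_cellP (dT _ xn)) => [] [b hb].
  have [-> [k hk] hC] := dom_after_up pl pk pn ha hb.
  rewrite -(step_prS _ xn) in hk hC.
  rewrite (cap_adds hk) (cap_adds hb); split=> //.
  - exact: column_target hC.
  - exact: differ_adds hk.
  - exact: (Slide_stay erefl erefl ha).
have [-> [k hk] hJ] := dom_after_down pl pk pn ha hb.
rewrite -(step_prS _ xn) in hk hJ.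
have hs := slide_source hJ.
rewrite cap_partC (cap_adds hb) cap_partC (cap_adds hk); split=> //.
- exact: differ_adds_rev hk.
- by case: hs => c hc; exact: (Column_stay erefl erefl hc).
Qed.

Lemma before0 T : oscillating_tableau T -> 0 < n -> before T 0.
Proof.
move=> [_ e0 _ dT] n0; rewrite /before step_pr0 //.
case: (differ_one_cellP (dT _ n0)); rewrite e0 //.
by case=> k /(_ k); rewrite row_empty eqxx; lia.
Qed.

Lemma crossing_exists T : oscillating_tableau T -> 0 < n ->
  exists p, [/\ 0 < p < n,
    (forall x, x < p -> before T x), (forall x, p <= x < n -> after T x) &
    (forall d, 0 < d < n -> neg_step T d = (d == p))].
Proof.
move=> oT n0.
pose P d := (0 < d < n) && neg_step T d.
have bef m : m < n -> (forall d, d <= m -> ~~ P d) -> before T m.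
  elim: m => [|m IH] mn hm; first exact: before0.
  have bm : before T m by apply: IH => [|d dm];
    [exact: ltnW|apply: hm; exact: leqW].
  have := hm _ (leqnn _); rewrite /P mn /= => nn.
  by have [] := before_step oT mn bm nn.
(* Without a negative entry pr T would stay strictly below T up to the empty
   shape at the end. *)
have exP : exists d, P d.
  case: (boolP [exists d : 'I_n, P d]) => [/existsP[d hd]|/existsPn nP].
    by exists (nat_of_ord d).
  have n1 : n.-1 < n by rewrite prednK.
  have [|a] := bef _ n1.
    move=> d dn; have dn' : d < n by lia.
    exact: (nP (Ordinal dn')).
  rewrite prednK //; case: oT => _ _ -> _ /(_ a).
  by rewrite row_empty eqxx; lia.
case: (ex_minnP exP) => p /andP[/andP[p0 pn] np] minp; exists p.
have befp x : x < p -> before T x.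
  move=> xp; apply: bef => [|d dx]; first exact: ltn_trans pn.
  by apply/negP=> /minp; lia.
have aft x : p <= x < n -> after T x.
  elim: x => [|x IH]; first by lia.
  case/andP; rewrite leq_eqVlt => /orP[/eqP e|px] xn.
    subst p; have xx := befp _ (ltnSn x).
    by have [] := cross_step oT xn xx np.
  have ax : after T x by apply: IH; lia.
  by have [] := after_step oT xn ax.
split=> //; first by rewrite p0.
move=> d /andP[d0 dn]; case: (ltngtP d p) => hd.
- by apply/negP=> nd; have := minp d; rewrite /P d0 dn nd => /(_ isT); lia.
- case: d d0 dn hd => // d _ dn hd.
  have ad : after T d by apply: aft; lia.
  by have [-> _ _ _ _] := after_step oT dn ad.
- by rewrite hd.
Qed.

Lemma oscillating_pr T : oscillating_tableau T -> 0 < n ->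
  oscillating_tableau (pr T).
Proof.
move=> oT n0; have [p [/andP[p0 pn] bef aft hneg]] := crossing_exists oT n0.
split; [by move=> j _; exact: step_pr_partition|exact: step_pr0|exact: step_prn|].
move=> j jn; case: (ltnP j.+1 n) => hj.
  case: (ltngtP j.+1 p) => jp.
  - have bj : before T j by apply: bef; exact: ltnW.
    have nj : ~~ neg_step T j.+1 by rewrite hneg //; lia.
    by have [] := before_step oT hj bj nj.
  - have aj : after T j by apply: aft; lia.
    by have [] := after_step oT hj aj.
  - have bj : before T j by apply: bef; lia.
    have nj : neg_step T j.+1 by rewrite hneg //; lia.
    by have [] := cross_step oT hj bj nj.
have e : j.+1 = n by lia.
have [a ha] : after T j by apply: aft; lia.
rewrite e in ha.
rewrite e step_prn; apply: (differ_adds_rev (k := a)).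
by case: oT ha => _ _ -> _.
Qed.

Lemma growth_edges T p : oscillating_tableau T -> 0 < p < n ->
  (forall x, x < p -> before T x) -> (forall x, p <= x < n -> after T x) ->
  (forall d, 0 < d < n -> neg_step T d = (d == p)) ->
  forall k x, x + k.+1 < n ->
  hedge p x (x + k.+1)
    (antidiag_label (pr T) k.+1 x) (antidiag_label T k.+1 x.+1)
    (antidiag_label (pr T) k x.+1) (antidiag_label T k x.+2) /\
  vedge p x (x + k)
    (antidiag_label (pr T) k.+1 x) (antidiag_label T k.+1 x.+1)
    (antidiag_label (pr T) k x) (antidiag_label T k x.+1).
Proof.
move=> oT /andP[p0 pn] bef aft hneg.
have oT' := oscillating_pr oT (ltn_trans p0 pn).
elim=> [|k IH] x hx.
  rewrite addn1 addn0 in hx *; rewrite /hedge /vedge.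
  case: (ltngtP x.+1 p) => jp.
  - have bj : before T x by apply: bef; exact: ltnW.
    have nj : ~~ neg_step T x.+1 by rewrite hneg //; lia.
    by have [] := before_step oT hx bj nj.
  - have aj : after T x by apply: aft; lia.
    by have [] := after_step oT hx aj.
  - have bj : before T x by apply: bef; lia.
    have nj : neg_step T x.+1 by rewrite hneg //; lia.
    by have [] := cross_step oT hx bj nj.
have hx1 : x + k.+1 < n by lia.
have hx2 : x.+1 + k.+1 < n by lia.
have [hh _] := IH x hx1; have [_ hv] := IH x.+1 hx2.
rewrite addSnnS in hv.
have xz : x < x + k.+1 by lia.
have [] := cell xz _ _ _ _ _ _ hh hv;
  try by apply: antidiag_label_partition => //; lia.
by move=> _ h1 h2; rewrite (addnS x k.+1).
Qed.

End Promotion.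

(** * Rotation of the growth matrix *)

Section Rotation.

Variables r n : nat.
Implicit Types (T : n.+1.-tuple (r.-tuple nat)).

(** The filling of the cell whose corners al, be, de are the labels at
(x, z), (x + 1, z), (x + 1, z + 1) for z = x + k + 1: the entry (x, x + k + 1)
of the growth matrix, with indices from 0. *)
Definition cell_filling T k x : nat :=
  (backward (antidiag_label T k.+1 x) (antidiag_label T k x.+1)
            (antidiag_label T k.+1 x.+1)).2.

(** The growth matrix with indices in nat. *)
Definition growth_entry T i j : nat :=
  if i == j then 0 else cell_filling T (maxn i j - minn i j).-1 (minn i j).

Lemma growth_entryC T i j : growth_entry T i j = growth_entry T j i.
Proof. by rewrite /growth_entry eq_sym maxnC minnC. Qed.

Lemma growth_entry_lt T i k : growth_entry T i (i + k).+1 = cell_filling T k i.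
Proof.
rewrite /growth_entry; have -> : i == (i + k).+1 = false by lia.
by congr cell_filling; lia.
Qed.

Lemma growth_matrixE T (i j : 'I_n) : growth_matrix T i j = growth_entry T i j.
Proof.
rewrite mxE /growth_entry -(inj_eq val_inj) /=; case: eqP => // /eqP ij.
have := ltn_ord i; have := ltn_ord j => jn hi.
rewrite /growth_filling /growth_label /cell_filling.
by do 3!f_equal; f_equal; lia.
Qed.

(** The index p is the crossing.  The second clause is the rotation of the
entries that are kept, the third one describes the first row of T and the
fourth one the last row of pr T. *)
Lemma growth_rotation T : oscillating_tableau T -> 0 < n -> exists p,
  [/\ forall d, 0 < d < n -> neg_step T d = (d == p),
      forall k x, x + k.+2 < n ->
        cell_filling T k x.+1 = cell_filling (pr T) k x,
      forall k, k.+1 < n -> cell_filling T k 0 = (k.+1 == p)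
    & forall k x, x + k.+2 = n -> cell_filling (pr T) k x = (x.+1 == p)].
Proof.
move=> oT n0; have [p [hp bef aft hneg]] := crossing_exists oT n0.
have oT' := oscillating_pr oT n0.
have edges := growth_edges oT hp bef aft hneg.
case/andP: (hp) => p0 pn; exists p; split=> //.
- move=> k x hx.
  have hx1 : x + k.+1 < n by lia.
  have hx2 : x.+1 + k.+1 < n by lia.
  have [hh _] := edges k x hx1; have [_ hv] := edges k x.+1 hx2.
  rewrite addSnnS in hv.
  have xz : x < x + k.+1 by lia.
  have [] := cell xz _ _ _ _ _ _ hh hv;
  try by apply: antidiag_label_partition => //; lia.
  by move=> e _ _; rewrite /cell_filling e.
- move=> k kn; rewrite /cell_filling (antidiag_label_left oT) //; last exact: ltnW.
  have k0n : 0 + k.+1 < n by [].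
  have [_] := edges k 0 k0n; rewrite add0n /vedge p0.
  rewrite !(antidiag_label_left oT') ?(ltnW kn) ?(ltnW (ltnW kn)) //.
  case: (ltngtP k.+1 p) => hk.
  + case=> [a _ <- _|a b _ _ h _|a c _ h _ _]; last 2 first.
    * by case: (adds_neq h).
    * by case: (adds_neq h).
    by rewrite backward_right.
  + by move=> [<- <-]; rewrite backward_right.
  + case=> <- _ [h hh _].
    have h0 : h = 0.
      apply: adds_empty_row hh; apply: antidiag_label_partition => //; lia.
    by rewrite h0 in hh; rewrite (backward_first hh).
- move=> k x hx.
  have hx1 : x + k.+1 < n by lia.
  have [] := edges k x hx1; rewrite /hedge /cell_filling => hh _.
  rewrite (antidiag_label_bottom (k := k.+1) (x := x.+1) oT') ?addSnnS //.
  move: hh; rewrite (antidiag_label_bottom (k := k.+1) (x := x.+1) oT) ?addSnnS //.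
  rewrite (antidiag_label_bottom (k := k) (x := x.+2) oT); last by lia.
  have -> : x + k.+1 < p = false by lia.
  case: (ltngtP x.+1 p) => hxp.
  + by case=> -> ->; rewrite backward_left.
  + case=> [a _ <- _|a b _ _ h _|a c _ h _ _]; last 2 first.
    * by case: (adds_neq h).
    * by case: (adds_neq h).
    by rewrite backward_left.
  + case=> -> _ [h hh _].
    have h0 : h = 0.
      apply: adds_empty_row hh; apply: antidiag_label_partition => //; lia.
    by rewrite h0 in hh; rewrite (backward_first hh).
Qed.

Lemma growth_entry_promotion T i j : oscillating_tableau T -> i < n -> j < n ->
  growth_entry T i j =
    let d := (j + n - i) %% n in
    if d == 0 then 0 else nat_of_bool (neg_step (iter i (@pr r n) T) d).
Proof.
move=> oT; elim: i j T oT => [|i IH] j T oT hi hj /=.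
  have [p [hneg _ hcol _]] := growth_rotation oT hi.
  rewrite subn0 modnDr modn_small //.
  case: j hj => [//|k] hk; have := growth_entry_lt T 0 k; rewrite add0n => ->.
  by rewrite hcol // hneg.
have n0 : 0 < n by lia.
have [p [hneg hrot hcol hlast]] := growth_rotation oT n0.
have oT' := oscillating_pr oT n0.
rewrite -iterS iterSr.
(* Column 0 of T becomes, by symmetry, the last column of pr T. *)
case: j hj => [|j] hj.
  rewrite growth_entryC -{1}[i]add0n growth_entry_lt hcol //.
  have n1 : n.-1 < n by rewrite prednK.
  have -> : 0 + n - i.+1 = n.-1 - i by lia.
  have := IH n.-1 (pr T) oT' (ltnW hi) n1.
  have -> : n.-1 + n - i = n.-1 - i + n by lia.
  rewrite modnDr => /= <-.
  have -> : n.-1 = (i + (n.-1 - i).-1).+1 by lia.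
  by rewrite growth_entry_lt hlast //; lia.
have -> : j.+1 + n - i.+1 = j + n - i by lia.
have /= <- := IH j (pr T) oT' (ltnW hi) (ltnW hj).
wlog ij : i j {IH} hi hj / i <= j.
  move=> H; case/orP: (leq_total i j) => ij; first exact: H.
  by rewrite growth_entryC [RHS]growth_entryC; exact: H.
case: (ltngtP i j) ij => [ij _|//|<- _]; last by rewrite /growth_entry !eqxx.
have -> : j = (i + (j - i).-1).+1 by lia.
by rewrite -addSn !growth_entry_lt hrot //; lia.
Qed.

End Rotation.

Theorem theorem4p4 (r n : nat) (hr : 0 < r) (hn : 0 < n)
    (T : n.+1.-tuple (r.-tuple nat)) (hT : oscillating_tableau T) :
  growth_matrix T = promotion_matrix T.
Proof.
apply/matrixP=> i j; rewrite growth_matrixE growth_entry_promotion //.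
by rewrite mxE.
Qed.
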